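(* Let $J$ be a (finite-dimensional) Jordan algebra over a field $\mathbb{F}$, let $\phi\in Aut(J)$ and let $W\in G_{s}(H^{2}(J,\mathbb{F}))$. Then $\Psi(W)=\Psi(\phi W)$.
   Context: A Jordan algebra over $\mathbb{F}$ is a commutative $\mathbb{F}$-algebra $(J,\circ)$ with $x^{2}\circ(x\circ y)=x\circ(x^{2}\circ y)$ for all $x,y$. $Z^{2}(J,\mathbb{F})$ is the space of symmetric bilinear forms $\theta:J\times J\to\mathbb{F}$ with $\theta(x^{2},x\circ y)=\theta(x,x^{2}\circ y)$ for all $x,y$; $B^{2}(J,\mathbb{F})=\{\delta f: f\in Hom(J,\mathbb{F})\}$ with $\delta f(x,y)=f(x\circ y)$; $H^{2}(J,\mathbb{F})=Z^{2}(J,\mathbb{F})/B^{2}(J,\mathbb{F})$, with $[\theta]$ the class of $\theta$. The radical of $\theta$ is $\theta^{\perp}=\{x\in J:\theta(x,y)=0\ \forall y\in J\}$. $G_s(H^2(J,\mathbb{F}))$ is the Grassmannian of $s$-dimensional subspaces of $H^2(J,\mathbb{F})$. $Aut(J)$ acts by $(\phi\theta)(x,y)=\theta(\phi(x),\phi(y))$ and $\phi\langle[\theta_1],\dots,[\theta_s]\rangle=\langle[\phi\theta_1],\dots,[\phi\theta_s]\rangle$. For $\theta_1,\dots,\theta_s\in Z^2(J,\mathbb{F})$, $\Psi(\theta_1,\dots,\theta_s)=(m_1,\dots,m_s)$ is the sequence $\dim\theta_1^{\perp},\dots,\dim\theta_s^{\perp}$ rearranged in descending order. For $W\in G_s(H^2(J,\mathbb{F}))$,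 $\Psi(W)$ (the characteristic sequence of dimensions of radicals) is the least upper bound, for the lexicographic order, of the set $\{\Psi(\theta_1,\dots,\theta_s):\theta_1,\dots,\theta_s\in Z^2(J,\mathbb{F}),\ W=\langle[\theta_1],\dots,[\theta_s]\rangle\}$. *)

(* Defs.v *)
From HB Require Import structures.
From mathcomp Require Import all_boot all_order all_algebra.
From mathcomp Require Import boolp classical_sets.

Set Implicit Arguments.
Unset Strict Implicit.
Unset Printing Implicit Defensive.

Import Order.TTheory GRing.Theory.

Local Open Scope ring_scope.
Local Open Scope quotient_scope.

Lemma linfunP (F : fieldType) (U V : vectType F) (f : U -> V) :
  linear f -> linfun f =1 f.
Proof.
move=> fL x.
pose fl : {linear U -> V} := HB.pack f (GRing.isLinear.Build F U V *:%R f fL).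
exact: (lfunE fl x).
Qed.

(* Classically, every linearly closed subset of a finite-dimensional space is
   (the carrier of) a {vspace _}, whose membership is a boolean predicate. *)
Lemma ex_vspace (F : fieldType) (V : vectType F) (P : V -> Prop) :
    P 0 -> (forall (a : F) u v, P u -> P v -> P (a *: u + v)) ->
  exists U : {vspace V}, forall v, v \in U <-> P v.
Proof.
move=> P0 PL.
pose Q n := `[< exists U : {vspace V},
                  (forall v, v \in U -> P v) /\ \dim U = n >].
have exQ : exists n, Q n.
  exists 0%N; apply/asboolP; exists 0%VS; split; last exact: dimv0.
  by move=> v; rewrite memv0 => /eqP ->.
have ubQ n : Q n -> (n <= \dim {:V})%N.
  by case/asboolP => U [_ <-]; apply/dimvS/subvf.
case: (ex_maxnP exQ ubQ) => n /asboolP[U [UP dimU]] maxn.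
exists U => v; split=> [/UP // | Pv].
have: Q (\dim (U + <[v]>)).
  apply/asboolP; exists (U + <[v]>)%VS; split=> // w.
  case/memv_addP => u uU [x /vlineP[k ->] ->].
  by rewrite addrC; apply: PL => //; apply: UP.
move/maxn; rewrite -dimU => le_dim.
have /eqP eqU : U == (U + <[v]>)%VS by rewrite eqEdim addvSl.
by rewrite eqU; apply: subvP (addvSr _ _) _ (memv_line v).
Qed.

Section QuotientSpace.
Variables (F : fieldType) (V : vectType F) (U : {vspace V}).

Definition quotv : Type := Quotient.quot U.
HB.instance Definition _ := Choice.on quotv.
HB.instance Definition _ := GRing.Zmodule.on quotv.
HB.instance Definition _ : @isZmodQuotient V (Quotient.equiv U) 0 -%R +%R quotv
  := @ZmodQuotient.on quotv.

Definition quotv_class (v : V) : quotv := \pi_quotv v.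

Lemma quotv_classP (u v : V) :
  quotv_class u = quotv_class v <-> u - v \in U.
Proof.
have E := Quotient.idealrBE U u v.
by split=> [/eqP | h]; [rewrite -E | apply/eqP; rewrite -E].
Qed.

Lemma quotv_reprK (q : quotv) : quotv_class (repr q) = q.
Proof. exact: reprK. Qed.

Lemma quotv_classD (u v : V) :
  quotv_class (u + v) = quotv_class u + quotv_class v.
Proof. exact: (raddfD (\pi_quotv)). Qed.

Definition quotv_scale (a : F) (q : quotv) : quotv := quotv_class (a *: repr q).

Lemma quotv_classZ a v : quotv_class (a *: v) = quotv_scale a (quotv_class v).
Proof.
apply/quotv_classP; rewrite -scalerBr; apply: memvZ.
by apply/quotv_classP; rewrite quotv_reprK.
Qed.

Fact quotv_scaleA a b q :
  quotv_scale a (quotv_scale b q) = quotv_scale (a * b) q.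
Proof. by rewrite -[q]quotv_reprK -!quotv_classZ scalerA. Qed.

Fact quotv_scale1 : left_id 1 quotv_scale.
Proof. by move=> q; rewrite -[q]quotv_reprK -!quotv_classZ scale1r. Qed.

Fact quotv_scaleDr : right_distributive quotv_scale +%R.
Proof.
move=> a p q; rewrite -[p]quotv_reprK -[q]quotv_reprK -quotv_classD.
by rewrite -!quotv_classZ -quotv_classD scalerDr.
Qed.

Fact quotv_scaleDl q : {morph quotv_scale^~ q : a b / a + b}.
Proof.
by move=> a b /=; rewrite -[q]quotv_reprK -!quotv_classZ -quotv_classD scalerDl.
Qed.

HB.instance Definition _ := GRing.Zmodule_isLmodule.Build F quotv
  quotv_scaleA quotv_scale1 quotv_scaleDr quotv_scaleDl.

Fact quotv_class_is_linear : linear quotv_class.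
Proof. by move=> a u v; rewrite quotv_classD quotv_classZ. Qed.

HB.instance Definition _ :=
  GRing.isLinear.Build F V quotv *:%R quotv_class quotv_class_is_linear.

Import VectorInternalTheory.
Fact quotv_vect_iso : Vector.axiom (dim (subvs_of U^C)) quotv.
Proof.
pose pr := daddv_pi (U^C)%VS U.
have cap0 : (U^C :&: U = 0)%VS by rewrite capvC capv_compl.
have prB v : v - pr v \in U.
  have vU : v \in (U^C + U)%VS by rewrite addvC addv_complf memvf.
  by rewrite -{1}(daddv_pi_add cap0 vU) addrC addKr memv_pi.
have prC v : pr v \in (U^C)%VS by apply: memv_pi.
pose g (q : quotv) : subvs_of U^C := vsproj _ (pr (repr q)).
have prU v : v \in U -> pr v = 0.
  move=> vU; apply/eqP; rewrite -memv0 -cap0 memv_cap prC.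
  by rewrite -[pr v](subKr v) memvB.
have gE v : g (quotv_class v) = vsproj _ (pr v).
  have dU : repr (quotv_class v) - v \in U.
    by apply/quotv_classP; rewrite quotv_reprK.
  congr vsproj; apply/eqP; rewrite -subr_eq0; apply/eqP.
  by rewrite -[RHS](prU _ dU) linearB.
have gL : linear g.
  move=> a p q; rewrite -[p]quotv_reprK -[q]quotv_reprK.
  by rewrite -linearP !gE !linearP.
exists (fun q => v2r (g q)); first by move=> a p q; rewrite gL linearP.
exists (fun r => quotv_class (vsval (r2v r : subvs_of U^C))) => [q|r].
  rewrite v2rK -{2}[q]quotv_reprK /g vsprojK //.
  by apply/quotv_classP; rewrite -opprB memvN.
by rewrite gE /pr daddv_pi_id ?subvsP // vsvalK r2vK.
Qed.

HB.instance Definition _ := Lmodule_hasFinDim.Build F quotv quotv_vect_iso.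

End QuotientSpace.

Section Grassmannian.
Variables (F : fieldType) (s : nat) (V : vectType F).

Record grassmannian :=
  Grassmannian { gr_space :> {vspace V}; _ : \dim gr_space == s }.

HB.instance Definition _ := [isSub for gr_space].
HB.instance Definition _ := [Choice of grassmannian by <:].

Lemma dim_grassmannian (W : grassmannian) : \dim W = s.
Proof. exact/eqP/(valP W). Qed.

End Grassmannian.

Reserved Notation "x ∘ y" (at level 40, left associativity).

(* The finite-dimensionality is that of the underlying vectType; linearity in
   the second argument follows from commutativity. No unit is required. *)
HB.mixin Record isJordan (F : fieldType) J of Vector F J := {
  jmul : J -> J -> J;
  jmulC : commutative jmul;
  jmul_linearl : forall z, linear (jmul^~ z);
  jordan_identity : forall x y,
    jmul (jmul x x) (jmul x y) = jmul x (jmul (jmul x x) y)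
}.

#[short(type="jordanAlgType")]
HB.structure Definition Jordan (F : fieldType) :=
  { J of isJordan F J & Vector F J }.

Notation "x ∘ y" := (jmul x y) : ring_scope.

Record jordan_aut (F : fieldType) (J : jordanAlgType F) := JordanAut {
  aut_fun :> 'End(J);
  aut_bij : bijective aut_fun;
  autM : {morph aut_fun : x y / x ∘ y}
}.

Section Cohomology.
Variables (F : fieldType) (J : jordanAlgType F).
Implicit Types (x y z : J) (a : F).

Lemma jmul_linearr z : linear (fun y => z ∘ y).
Proof. by move=> a x y; rewrite ![z ∘ _]jmulC jmul_linearl. Qed.

(* Bilinear forms J * J -> F in curried form; theta(x, y) is [theta x y]. *)
Definition bilform := 'Hom(J, 'Hom(J, F^o)).
Implicit Types theta : bilform.

Definition is_cocycle theta : Prop :=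
  (forall x y, theta x y = theta y x) /\
  (forall x y, theta (x ∘ x) (x ∘ y) = theta x ((x ∘ x) ∘ y)).

Lemma ex_Z2 : exists U : {vspace bilform}, forall theta,
  theta \in U <-> is_cocycle theta.
Proof.
apply: ex_vspace; first by split=> x y; rewrite !zero_lfunE.
move=> a t1 t2 [t1C t1J] [t2C t2J].
split=> x y; rewrite !(add_lfunE, scale_lfunE).
  by rewrite t1C t2C.
by rewrite t1J t2J.
Qed.

Definition Z2 : {vspace bilform} := sval (cid ex_Z2).

Lemma Z2P theta : theta \in Z2 <-> is_cocycle theta.
Proof. exact: (svalP (cid ex_Z2)). Qed.

Definition cocycle := subvs_of Z2.

Definition coboundary (f : 'Hom(J, F^o)) : bilform :=
  linfun (fun x => linfun (fun y => f (x ∘ y)) : 'Hom(J, F^o)).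

Lemma coboundaryE f x y : coboundary f x y = f (x ∘ y).
Proof.
have L z : linear (fun y => f (z ∘ y)).
  by move=> a u v; rewrite jmul_linearr linearP.
rewrite linfunP ?linfunP // => a u v.
by apply/lfunP => w; rewrite add_lfunE scale_lfunE !linfunP // jmul_linearl linearP.
Qed.

Definition B2 : {vspace bilform} := limg (linfun coboundary).

Lemma B2P theta :
  theta \in B2 <->
  exists f : 'Hom(J, F^o), forall x y, theta x y = f (x ∘ y).
Proof.
have L : linear coboundary.
  move=> a f g; apply/lfunP => x; apply/lfunP => y.
  by rewrite !(add_lfunE, scale_lfunE, coboundaryE).
split=> [/memv_imgP[f _ ->] | [f fE]].
  by exists f => x y; rewrite linfunP // coboundaryE.
have -> : theta = linfun coboundary f.
  apply/lfunP => x; apply/lfunP => y.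
  by rewrite linfunP // coboundaryE fE.
by rewrite memv_img // memvf.
Qed.

Lemma B2_sub_Z2 : (B2 <= Z2)%VS.
Proof.
apply/subvP => t /B2P[f fE]; apply/Z2P; split=> x y; rewrite !fE.
  by rewrite jmulC.
by rewrite jordan_identity.
Qed.

Definition H2 :=
  quotv (linfun (vsval : cocycle -> bilform) @^-1: B2)%VS.

Definition coclass (theta : cocycle) : H2 := quotv_class _ theta.

Lemma coclassP (t1 t2 : cocycle) :
  coclass t1 = coclass t2 <-> vsval t1 - vsval t2 \in B2.
Proof.
rewrite -linearB /=; split=> [/quotv_classP|].
  by rewrite -memv_preim linfunP //; apply: linearP.
move=> h; apply/quotv_classP; rewrite -memv_preim linfunP //.
Qed.

Lemma coclass_linear : linear coclass.
Proof. exact: quotv_class_is_linear. Qed.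

Definition radical theta : {vspace J} := lker theta.

Lemma radicalP theta x :
  x \in radical theta <-> forall y, theta x y = 0.
Proof.
rewrite memv_ker; split=> [/eqP-> y|h]; first by rewrite zero_lfunE.
by apply/eqP/lfunP => y; rewrite h zero_lfunE.
Qed.

(* The lexicographic order is carried by the alias [s.-tuplelexi nat]
   of [s.-tuple nat]. *)
Definition rad_seq s (t : s.-tuple cocycle) : s.-tuplelexi nat :=
  [tuple of sort geq [tuple of [seq \dim (radical (vsval u)) | u <- t]]].

Definition rad_seqs s (W : grassmannian s H2) : set (s.-tuplelexi nat) :=
  [set m | exists2 t : s.-tuple cocycle,
             (W : {vspace H2}) = <<map coclass t>>%VS & m = rad_seq t]%classic.

(* The default value of [supremum] is never used, see [char_seqP]. *)
Definition char_seq s (W : grassmannian s H2) : s.-tuplelexi nat :=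
  supremum (nseq_tuple s 0%N : s.-tuplelexi nat) (rad_seqs W).

Lemma rad_seqs_neq0 s (W : grassmannian s H2) : (rad_seqs W !=set0)%classic.
Proof.
have dW := dim_grassmannian W.
pose b := tcast dW (vbasis W).
have bW : <<b>>%VS = W by rewrite val_tcast (span_basis (vbasisP W)).
exists (rad_seq [tuple of [seq (repr h : cocycle) | h <- b]]).
exists [tuple of [seq (repr h : cocycle) | h <- b]] => //=.
rewrite -map_comp map_id_in ?bW // => h _ /=.
exact: quotv_reprK.
Qed.

Lemma rad_seq_le s (t : s.-tuple cocycle) :
  all (fun m => m < (dim J).+1)%N (rad_seq t).
Proof.
rewrite /= all_sort all_map; apply/allP => u _ /=.
by rewrite ltnS -dimvf dimvS ?subvf.
Qed.

Lemma char_seq_max s (W : grassmannian s H2) :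
  exists2 m, rad_seqs W m & ubound (rad_seqs W) m.
Proof.
pose emb (c : s.-tuple 'I_(dim J).+1) : s.-tuplelexi nat :=
  [tuple of map val c].
have surj m : rad_seqs W m -> exists c, emb c = m.
  case=> t _ ->; exists [tuple of map inord (rad_seq t)].
  apply: val_inj; rewrite /= -map_comp map_id_in // => x xt /=.
  by rewrite inordK //; have /allP := rad_seq_le t; apply.
pose P c := `[< rad_seqs W (emb c) >].
have [m0 m0W] := rad_seqs_neq0 W.
have [c0 c0E] := surj _ m0W.
have Pc0 : P c0 by apply/asboolP; rewrite c0E.
case: (@Order.TotalTheory.arg_maxP _ _ _ c0 P emb Pc0) => c /asboolP Pc maxc.
exists (emb c) => // m mW; have [d dE] := surj _ mW.
by rewrite -dE; apply: maxc; apply/asboolP; rewrite dE.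
Qed.

Lemma char_seqP s (W : grassmannian s H2) : isLub (rad_seqs W) (char_seq W).
Proof.
have [m mW mub] := char_seq_max W.
have supm : supremums (rad_seqs W) m by split=> // x; apply.
have ne0 : (rad_seqs W == set0)%classic = false.
  by apply/negP => /eqP E; move: mW; rewrite E.
rewrite /char_seq /supremum ne0.
have [h1 h2] := xgetPex (nseq_tuple s 0%N : s.-tuplelexi nat) (ex_intro _ m supm).
by split=> // b; apply: h2.
Qed.

Section Action.
Variable phi : jordan_aut J.

Definition act_form theta : bilform :=
  linfun (fun x => (theta (phi x) \o phi)%VF : 'Hom(J, F^o)).

Lemma act_formE theta x y : act_form theta x y = theta (phi x) (phi y).
Proof.
rewrite linfunP ?comp_lfunE // => a u v.
by apply/lfunP => w; rewrite !(add_lfunE, scale_lfunE, comp_lfunE, linearP).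
Qed.

Fact act_form_Z2 (theta : cocycle) : act_form (vsval theta) \in Z2.
Proof.
have /Z2P[tC tJ] := subvsP theta.
apply/Z2P; split=> x y; rewrite !act_formE; first exact: tC.
rewrite !autM; exact: tJ.
Qed.

Definition act_cocycle (theta : cocycle) : cocycle :=
  Subvs (act_form_Z2 theta).

Definition act_H2 : 'End(H2) :=
  linfun (fun h : H2 => coclass (act_cocycle (repr h))).

Lemma act_cocycle_linear : linear act_cocycle.
Proof.
move=> a t u; apply: val_inj; apply/lfunP => x; apply/lfunP => y.
by rewrite /= !(add_lfunE, scale_lfunE, act_formE).
Qed.

Lemma act_B2 theta : (act_form theta \in B2) = (theta \in B2).
Proof.
apply/idP/idP => /B2P[f fE]; apply/B2P; last first.
  by exists (f \o phi)%VF => x y; rewrite act_formE fE -autM comp_lfunE.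
have [g gK Kg] := aut_bij phi.
have ker0 : lker phi == 0%VS by apply/lker0P/(can_inj gK).
exists (f \o phi^-1)%VF => x y; rewrite comp_lfunE -[x]Kg -[y]Kg.
by rewrite -autM lker0_lfunK // -fE act_formE.
Qed.

Lemma coclass_act t u :
  coclass (act_cocycle t) = coclass (act_cocycle u) <-> coclass t = coclass u.
Proof.
have /(_ (vsval t - vsval u)) := act_B2.
rewrite -linearB /= => E; split=> /coclassP; rewrite -linearB => h.
  apply/coclassP; rewrite -linearB -E; move: h.
  by rewrite -scaleN1r addrC -act_cocycle_linear scaleN1r addrC.
apply/coclassP; rewrite -linearB.
by rewrite -scaleN1r addrC -act_cocycle_linear scaleN1r addrC /= E.
Qed.

Lemma act_H2E (theta : cocycle) : act_H2 (coclass theta) = coclass (act_cocycle theta).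
Proof.
have E t : coclass (act_cocycle (repr (coclass t))) = coclass (act_cocycle t).
  by apply/coclass_act; apply: quotv_reprK.
rewrite linfunP // => a p q; rewrite -[p]quotv_reprK -[q]quotv_reprK.
by rewrite -coclass_linear !E act_cocycle_linear coclass_linear.
Qed.

Lemma act_H2_ker0 : lker act_H2 == 0%VS.
Proof.
apply/lker0P => p q; rewrite -[p]quotv_reprK -[q]quotv_reprK.
by rewrite !act_H2E => /coclass_act.
Qed.

Lemma act_H2_span (ts : seq cocycle) :
  (act_H2 @: <<map coclass ts>>)%VS = <<map coclass (map act_cocycle ts)>>%VS.
Proof.
rewrite limg_span -!map_comp; congr span.
by apply: eq_map => t; apply: act_H2E.
Qed.

Fact act_gr_dim s (W : grassmannian s H2) : \dim (act_H2 @: W) == s.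
Proof.
by rewrite limg_dim_eq ?dim_grassmannian // (eqP act_H2_ker0) capv0.
Qed.

Definition act_gr s (W : grassmannian s H2) : grassmannian s H2 :=
  Grassmannian (act_gr_dim W).

End Action.
End Cohomology.

(* Main.v *)
(** A form [theta] and its translate [phi theta] have radicals of the same
    dimension, because [phi] maps the radical of [phi theta] isomorphically
    onto that of [theta].  Since [phi] acts bijectively on cocycles, the tuples
    spanning [phi W] are exactly the translates of the tuples spanning [W], so
    both characteristic sequences are suprema of the same set. *)

Require Import Defs.
From mathcomp Require Import all_boot all_order all_algebra.
From mathcomp Require Import classical_sets.

Section AutAction.
Variables (F : fieldType) (J : jordanAlgType F) (phi : jordan_aut J).

Lemma aut_ker0 : lker phi == 0%VS.
Proof. by have [g gK _] := aut_bij phi; apply/lker0P/(can_inj gK). Qed.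

Lemma radical_act (theta : bilform J) :
  (phi @: radical (act_form phi theta))%VS = radical theta.
Proof.
have phiK := lker0_lfunVK aut_ker0.
apply/vspaceP => x; apply/idP/idP.
  case/memv_imgP => y /radicalP rad_y ->; apply/radicalP => z.
  (* As [phi] is onto, the test vector [z] is an image under [phi]. *)
  by rewrite -[z]phiK -act_formE rad_y.
move=> /radicalP rad_x; rewrite -[x]phiK memv_img //; apply/radicalP => z.
by rewrite act_formE phiK rad_x.
Qed.

Lemma dim_radical_act (theta : bilform J) :
  \dim (radical (act_form phi theta)) = \dim (radical theta).
Proof.
by rewrite -(radical_act theta) limg_dim_eq // (eqP aut_ker0) capv0.
Qed.

Lemma rad_seq_act s (t : s.-tuple (cocycle J)) :
  rad_seq [tuple of map (act_cocycle phi) t] = rad_seq t.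
Proof.
apply: val_inj; congr sort; rewrite /= -map_comp.
by apply: eq_map => u /=; apply: dim_radical_act.
Qed.

(** The action is linear, and injective because [phi] is onto; finite dimension then makes it
    bijective. *)
Lemma act_cocycle_surj :
  exists f : cocycle J -> cocycle J, cancel f (act_cocycle phi).
Proof.
have actE := linfunP (act_cocycle_linear phi).
have ker0 : lker (linfun (act_cocycle phi)) == 0%VS.
  apply/lker0P => t u; rewrite !actE => /(congr1 val) /= eq_tu.
  apply/val_inj/lfunP => x; apply/lfunP => y.
  have phiK := lker0_lfunVK aut_ker0.
  by rewrite -[x]phiK -[y]phiK -!act_formE eq_tu.
exists (linfun (act_cocycle phi))^-1%VF => t.
by rewrite -actE lker0_lfunVK.
Qed.

Lemma rad_seqs_act s (W : grassmannian s (H2 J)) :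
  rad_seqs (act_gr phi W) = rad_seqs W.
Proof.
apply/seteqP; split=> m [t defW ->].
  (* A tuple spanning [phi W] is pulled back along the right inverse [f]. *)
  have [f fK] := act_cocycle_surj.
  have tE : t = [tuple of map (act_cocycle phi) (map_tuple f t)].
    by apply: val_inj; rewrite /= -map_comp map_id_in // => u _ /=; apply: fK.
  exists (map_tuple f t); last by rewrite {1}tE rad_seq_act.
  (* Injectivity on [H2] allows comparing images instead; both are the span of the classes of
     [t]. *)
  apply/eqP; rewrite -(eq_limg_ker0 _ _ (act_H2_ker0 phi)).
  by rewrite act_H2_span -[map (act_cocycle phi) _]/(tval [tuple of map _ _]) -tE -defW.
exists [tuple of map (act_cocycle phi) t]; last by rewrite rad_seq_act.
by rewrite /= defW act_H2_span.
Qed.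

End AutAction.

Theorem lemma4p2 (F : fieldType) (J : jordanAlgType F) (phi : jordan_aut J)
  (s : nat) (W : grassmannian s (H2 J)) :
  char_seq W = char_seq (act_gr phi W).
Proof. by rewrite /char_seq rad_seqs_act. Qed.
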